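(* Let $\mathcal{O}=\mathcal{O}_{1,1}$ be the split Okubo algebra over a field $\mathbb{F}$ of characteristic not $3$ and containing a primitive cubic root of $1$, with its canonical $(\mathbb{Z}/3)^2$-grading $\Gamma_{1,1}$. Then $\mathrm{Aut}(\Gamma_{1,1})$ is isomorphic to the projective unitary group $\mathrm{PU}(3,2^2)$.
   Context: Split Okubo algebra and its canonical grading. For a field $\mathbb{F}$, the split Okubo algebra $\mathcal{O}_{1,1}=\mathcal{O}_{\mathbb{F}}$ is the $8$-dimensional $\mathbb{F}$-algebra with basis $\{z_{i,j} : (i,j)\in(\mathbb{Z}/3)^2,\ (i,j)\neq(0,0)\}$ and multiplication $$z_{i,j}*z_{i',j'}=\begin{cases}0&\text{if }\Delta=2\text{ or }i+i'=0=j+j',\\ -z_{i+i',j+j'}&\text{if }\Delta=1,\\ z_{i+i',j+j'}&\text{otherwise,}\end{cases}\qquad \Delta=ij'-ji'\in\mathbb{Z}/3.$$ The grading $\Gamma_{1,1}$ is the $(\mathbb{Z}/3)^2$-grading with $\deg(z_{i,j})=(i,j)$, i.e. its nonzero homogeneous components are the lines $\mathbb{F}z_{i,j}$. $\mathrm{Aut}(\Gamma_{1,1})$ is the group of algebra automorphisms of $\mathcal{O}_{1,1}$ that permute the nonzero homogeneous components of $\Gamma_{1,1}$. Unitary groups. Let $\mathbb{F}_4$ be the field of four elements. $\mathrm{U}(3,2^2)$ is the subgroup of $\mathrm{GL}_3(\mathbb{F}_4)$ consisting of the matrices $a$ with $a^\dagger a=1$, where $a^\dagger$ is the transpose of the matrix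 obtained from $a$ by applying $\alpha\mapsto\alpha^2$ to all entries. $\mathrm{PU}(3,2^2)$ is the quotient of $\mathrm{U}(3,2^2)$ by its subgroup of scalar matrices. *)

(* Defs.v *)
From HB Require Import structures.
From mathcomp Require Import all_boot all_algebra all_fingroup all_solvable all_field.
From mathcomp Require Import boolp.
Set Implicit Arguments.
Unset Strict Implicit.
Unset Printing Implicit Defensive.
Import GRing.Theory.
Local Open Scope ring_scope.

Notation Z3sq := ('Z_3 * 'Z_3)%type.
Notation okubo_index := {g : Z3sq | g != 0}.

(* As a module only: the ring product that {ffun _ -> F^o} inherits is
   pointwise, the product of the Okubo algebra is okubo_mul below. *)
Notation okubo F := {ffun okubo_index -> F^o}.

Section Okubo.
Variable F : fieldType.

(* For g != 0 this is the basis vector z_g; okubo_z 0 = 0. *)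
Definition okubo_z (g : Z3sq) : okubo F := [ffun d => (val d == g)%:R : F^o].

Definition okubo_delta (g h : Z3sq) : 'Z_3 := g.1 * h.2 - g.2 * h.1.

Definition okubo_zmul (g h : Z3sq) : okubo F :=
  if (okubo_delta g h == 2%:R) || (g + h == 0) then 0
  else if okubo_delta g h == 1 then - okubo_z (g + h)
  else okubo_z (g + h).

Definition okubo_mul (x y : okubo F) : okubo F :=
  \sum_(d : okubo_index) \sum_(e : okubo_index)
    (x d * y e) *: okubo_zmul (val d) (val e).

Lemma okubo_mul_z (d e : okubo_index) :
  okubo_mul (okubo_z (val d)) (okubo_z (val e)) = okubo_zmul (val d) (val e).
Proof.
rewrite /okubo_mul (bigD1 d) //= [X in _ + X]big1 ?addr0 => [|d' nd].
  rewrite (bigD1 e) //= [X in _ + X]big1 ?addr0 => [|e' ne].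
    by rewrite !ffunE !eqxx mulr1 scale1r.
  by rewrite !ffunE !(inj_eq val_inj) (negbTE ne) mulr0 scale0r.
apply: big1 => e' _.
by rewrite !ffunE !(inj_eq val_inj) (negbTE nd) mul0r scale0r.
Qed.

Lemma okubo_coord (x : okubo F) :
  x = \sum_(d : okubo_index) x d *: okubo_z (val d).
Proof.
apply/ffunP => e; rewrite sum_ffunE (bigD1 e) //= [X in _ + X]big1.
  by rewrite !ffunE eqxx addr0 /GRing.scale /= mulr1.
move=> d nd; rewrite !ffunE !(inj_eq val_inj) eq_sym (negbTE nd).
by rewrite /GRing.scale /= mulr0.
Qed.

(* The nonzero homogeneous components of the grading deg z_g = g. *)
Definition okubo_component (d : okubo_index) : {vspace okubo F} :=
  <[okubo_z (val d)]>%VS.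

Definition is_okubo_aut (f : 'End(okubo F)) : Prop :=
  bijective f /\ {morph f : x y / okubo_mul x y}.

Definition permutes_components (f : 'End(okubo F)) : Prop :=
  exists s : {perm okubo_index},
    forall d, (f @: okubo_component d)%VS = okubo_component (s d).

Definition okubo_graded_aut : Type :=
  {f : 'End(okubo F) | `[< is_okubo_aut f /\ permutes_components f >]}.
HB.instance Definition _ := Choice.on okubo_graded_aut.
HB.instance Definition _ := SubType.on okubo_graded_aut.

Lemma okubo_graded_autP (f : okubo_graded_aut) :
  is_okubo_aut (val f) /\ permutes_components (val f).
Proof. exact/asboolP/(valP f). Qed.

Lemma okubo_graded_aut_ker (f : okubo_graded_aut) : lker (val f) == 0%VS.
Proof.
by have [[bij_f _] _] := okubo_graded_autP f; apply/lker0P/bij_inj.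
Qed.

Fact okubo_aut1_subproof :
  `[< is_okubo_aut \1%VF /\ permutes_components \1%VF >].
Proof.
apply/asboolP; split; first split.
- by exists id => x; rewrite lfunE.
- by move=> x y; rewrite !lfunE.
- by exists 1%g => d; rewrite lim1g perm1.
Qed.

Definition okubo_aut1 : okubo_graded_aut := exist _ \1%VF okubo_aut1_subproof.

Fact okubo_autM_subproof (f g : okubo_graded_aut) :
  `[< is_okubo_aut (val f \o val g)%VF
      /\ permutes_components (val f \o val g)%VF >].
Proof.
have [[[f' fK f'K] fM] [s sP]] := okubo_graded_autP f.
have [[[g' gK g'K] gM] [t tP]] := okubo_graded_autP g.
apply/asboolP; split; first split.
- by exists (g' \o f') => x; rewrite /= ?comp_lfunE /= ?fK ?gK ?g'K ?f'K.
- by move=> x y; rewrite !comp_lfunE gM fM.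
- by exists (t * s)%g => d; rewrite limg_comp tP sP permM.
Qed.

Definition okubo_autM (f g : okubo_graded_aut) : okubo_graded_aut :=
  exist _ (val f \o val g)%VF (okubo_autM_subproof f g).

Fact okubo_autV_subproof (f : okubo_graded_aut) :
  `[< is_okubo_aut (val f)^-1%VF /\ permutes_components (val f)^-1%VF >].
Proof.
have kf := okubo_graded_aut_ker f.
have [[bij_f fM] [s sP]] := okubo_graded_autP f.
have fK := lker0_lfunK kf; have fVK := lker0_lfunVK kf.
apply/asboolP; split; first split.
- by exists (val f).
- by move=> x y; apply: (bij_inj bij_f); rewrite fM !fVK.
- exists s^-1%g => d.
  by rewrite -{1}[d](permKV s) -sP -limg_comp lker0_compVf // lim1g.
Qed.

Definition okubo_autV (f : okubo_graded_aut) : okubo_graded_aut :=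
  exist _ (val f)^-1%VF (okubo_autV_subproof f).

Fact okubo_autMA : associative okubo_autM.
Proof. by move=> f g h; apply: val_inj; rewrite /= comp_lfunA. Qed.

Fact okubo_aut1M : left_id okubo_aut1 okubo_autM.
Proof. by move=> f; apply: val_inj; rewrite /= comp_lfun1l. Qed.

Fact okubo_autM1 : right_id okubo_aut1 okubo_autM.
Proof. by move=> f; apply: val_inj; rewrite /= comp_lfun1r. Qed.

Fact okubo_autVM : left_inverse okubo_aut1 okubo_autV okubo_autM.
Proof.
by move=> f; apply: val_inj; rewrite /= lker0_compVf ?okubo_graded_aut_ker.
Qed.

Fact okubo_autMV : right_inverse okubo_aut1 okubo_autV okubo_autM.
Proof.
by move=> f; apply: val_inj; rewrite /= lker0_compfV ?okubo_graded_aut_ker.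
Qed.

HB.instance Definition _ := isGroup.Build okubo_graded_aut
  okubo_autMA okubo_aut1M okubo_autM1 okubo_autVM okubo_autMV.

End Okubo.

Section Unitary.
Variable K : finFieldType.

Definition dagger (A : 'M[K]_3) : 'M[K]_3 := (map_mx (fun a => a ^+ 2) A)^T.

Definition unitary3_set : {set {'GL_3[K]}} :=
  [set a : {'GL_3[K]} | dagger (GLval a) *m GLval a == 1%:M].

(* The entrywise square is a ring morphism only in characteristic 2, so the
   group structures depend on the proof that K has four elements. *)
Hypothesis cardK : #|K| = 4%N.

Lemma field4_pchar2 : 2%N \in [pchar K].
Proof. exact: (@card_finPcharP K 2 2). Qed.

Lemma daggerM (A B : 'M[K]_3) : dagger (A *m B) = dagger B *m dagger A.
Proof.
rewrite /dagger -trmx_mul; congr (_^T).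
exact: (map_mxM (pFrobenius_aut field4_pchar2)).
Qed.

Lemma dagger1 : dagger 1%:M = 1%:M.
Proof.
rewrite /dagger (map_mx1 (pFrobenius_aut field4_pchar2)); exact: trmx1.
Qed.

Fact unitary3_group_set : group_set unitary3_set.
Proof.
apply/group_setP; split => [|a b]; first by rewrite inE dagger1 mulmx1.
rewrite !inE => /eqP ua /eqP ub.
by rewrite GL_ME daggerM mulmxA -(mulmxA (dagger _)) ua mulmx1 ub.
Qed.

Definition unitary3 : {group {'GL_3[K]}} := Group unitary3_group_set.

Definition scalar_unitary3_set : {set {'GL_3[K]}} :=
  [set a : {'GL_3[K]} in unitary3 | is_scalar_mx (GLval a)].

Fact scalar_unitary3_group_set : group_set scalar_unitary3_set.
Proof.
apply/group_setP; split => [|a b].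
  by rewrite 2!inE dagger1 mulmx1 eqxx scalar_mx_is_scalar.
rewrite inE => /andP[ua /is_scalar_mxP[x ax]].
rewrite inE => /andP[ub /is_scalar_mxP[y bx]].
rewrite inE groupM //=.
rewrite -[X in is_scalar_mx X]/(GLval a *m GLval b).
by rewrite ax bx -scalar_mxM scalar_mx_is_scalar.
Qed.

Definition scalar_unitary3 : {group {'GL_3[K]}} :=
  Group scalar_unitary3_group_set.

Lemma scalar_unitary3_normal : (scalar_unitary3 <| unitary3)%g.
Proof.
apply: sub_center_normal; apply/subsetP => a.
rewrite [a \in _]inE => /andP[ua /is_scalar_mxP[x ax]].
apply/centerP; split => // b _.
apply: val_inj.
by rewrite -[LHS]/(GLval a *m GLval b) -[RHS]/(GLval b *m GLval a) ax scalar_mxC.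
Qed.

Definition projective_unitary3 : {group coset_of scalar_unitary3} :=
  (unitary3 / scalar_unitary3)%G.

End Unitary.

Definition group_isomorphic (G H : groupType) : Prop :=
  exists phi : G -> H, bijective phi /\ {morph phi : x y / (x * y)%g}.

(* Main.v *)
Require Import Defs.
From HB Require Import structures.
From mathcomp Require Import all_boot all_algebra all_fingroup all_solvable all_field.
From mathcomp Require Import boolp ring.
Set Implicit Arguments.
Unset Strict Implicit.
Unset Printing Implicit Defensive.
Import GRing.Theory.
Local Open Scope ring_scope.

(* Both groups act on (Z/3)^2 through the same data. Let w be a primitive cubic
   root of 1 in F. An automorphism permuting the lines F z_x is of the form
   z_x |-> w^(k x) z_(s x), where k is a character and s is linear and preserves
   the determinant form Delta, and all such pairs (s, k) occur. On the unitary
   side, let om be a primitive cubic root of 1 in K and let W_x, x in (Z/3)^2,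
   be the Weyl (generalized Pauli) matrices, W_x W_y = om^Delta(x,y) W_(x+y).
   Conjugation by a unitary matrix A maps W_x to om^(k x) W_(s x), again with
   (s, k) as above, and all such pairs occur; these two facts are checked by
   enumerating the 648 unitary matrices over the field with four elements.
   Finally A determines (s, k), which determines A up to a scalar, since only
   the scalar matrices commute with all the W_x. *)

(** * Symplectic maps of (Z/3)^2 *)

Lemma exprZ3D (R : pzSemiRingType) (x : R) (a b : 'Z_3) :
  x ^+ 3 = 1 -> x ^+ (a + b)%R = x ^+ a * x ^+ b.
Proof. by move=> x3; rewrite -exprD /= expr_mod. Qed.

Lemma exprZ3_eq1 (R : fieldType) (x : R) (a : 'Z_3) :
  3.-primitive_root x -> x ^+ a = 1 -> a = 0.
Proof.
move=> px /eqP; rewrite -(prim_order_dvd px).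
by case: a => [[|[|[|]]] // ?] _; apply/val_inj.
Qed.

Lemma prim3_expr_neq0 (R : fieldType) (x : R) n :
  3.-primitive_root x -> x ^+ n != 0.
Proof.
move=> px; rewrite expf_neq0 //.
apply: contra_eq_neq (prim_expr_order px) => ->.
by rewrite expr0n eq_sym oner_neq0.
Qed.

Definition Z3sq_e1 : Z3sq := (1, 0).
Definition Z3sq_e2 : Z3sq := (0, 1).
(** The linear map taking the basis to [g], [h]; its determinant is [okubo_delta g h], so it is
    symplectic when this value is 1. *)
Definition lin (g h x : Z3sq) : Z3sq :=
  (x.1 * g.1 + x.2 * h.1, x.1 * g.2 + x.2 * h.2).
Definition chr (k l : 'Z_3) (x : Z3sq) : 'Z_3 := x.1 * k + x.2 * l.

Lemma okubo_delta_lin g h x y :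
  okubo_delta (lin g h x) (lin g h y) = okubo_delta g h * okubo_delta x y.
Proof. rewrite /okubo_delta /lin /=; ring. Qed.

Lemma linD g h x y : lin g h (x + y) = lin g h x + lin g h y.
Proof. by congr pair; rewrite /=; ring. Qed.

Lemma chrD k l x y : chr k l (x + y) = chr k l x + chr k l y.
Proof. rewrite /chr /=; ring. Qed.

Lemma chr0 k l : chr k l 0 = 0.
Proof. by rewrite /chr /= !mul0r addr0. Qed.

Lemma chr_e1 k l : chr k l Z3sq_e1 = k.
Proof. by rewrite /chr /= mul1r mul0r addr0. Qed.

Lemma chr_e2 k l : chr k l Z3sq_e2 = l.
Proof. by rewrite /chr /= mul1r mul0r add0r. Qed.

Lemma lin0 g h : lin g h 0 = 0.
Proof. by congr pair; rewrite /= !mul0r addr0. Qed.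

Lemma lin_e1 g h : lin g h Z3sq_e1 = g.
Proof. by case: g => ??; congr pair; rewrite /=; ring. Qed.

Lemma lin_e2 g h : lin g h Z3sq_e2 = h.
Proof. by case: h => ??; congr pair; rewrite /=; ring. Qed.

Lemma Z3sq_coord (x : Z3sq) : x = Z3sq_e1 *+ x.1 + Z3sq_e2 *+ x.2.
Proof.
by case: x => [[[|[|[|]]] // ?] [[|[|[|]]] // ?]]; congr pair; apply/val_inj.
Qed.

Lemma Z3sq_gen (P : Z3sq -> Prop) :
  P 0 -> P Z3sq_e1 -> P Z3sq_e2 -> (forall x y, P x -> P y -> P (x + y)) ->
  forall x, P x.
Proof.
move=> P0 P1 P2 PD x; rewrite [x]Z3sq_coord.
have PM n y : P y -> P (y *+ n).
  by move=> Py; elim: n => [|n IH]; rewrite ?mulr0n // mulrS; apply: PD.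
by apply: PD; apply: PM.
Qed.

Lemma additive_lin (s : Z3sq -> Z3sq) :
  s 0 = 0 -> {morph s : x y / x + y} -> s =1 lin (s Z3sq_e1) (s Z3sq_e2).
Proof.
move=> s0 sD; apply: Z3sq_gen => [|||x y ex ey].
- by rewrite lin0.
- by rewrite lin_e1.
- by rewrite lin_e2.
- by rewrite linD sD ex ey.
Qed.

Lemma okubo_deltaC x y : okubo_delta x y = - okubo_delta y x.
Proof. rewrite /okubo_delta; ring. Qed.

Lemma Z3_cases (a : 'Z_3) : [\/ a = 0, a = 1 | a = 2%:R].
Proof.
case: a => [[|[|[|]]] // ?].
- by constructor 1; apply/val_inj.
- by constructor 2; apply/val_inj.
- by constructor 3; apply/val_inj.
Qed.

Lemma okubo_delta_nondeg x : (forall y, okubo_delta x y = 0) -> x = 0.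
Proof.
move=> x0; have := x0 Z3sq_e1; have := x0 Z3sq_e2.
rewrite /okubo_delta /= !mulr1 !mulr0 subr0 add0r.
by case: x {x0} => a b /= -> /eqP; rewrite oppr_eq0 => /eqP ->.
Qed.

(** A map preserving a nondegenerate form has trivial kernel. *)
Lemma lin_inj g h : okubo_delta g h = 1 -> injective (lin g h).
Proof.
move=> d1 x y exy; apply/subr0_eq/okubo_delta_nondeg => z.
rewrite -[LHS]mul1r -d1 -okubo_delta_lin.
have: lin g h (x - y) + lin g h y = lin g h y by rewrite -linD subrK.
move=> /(canRL (addrK _)) ->; rewrite subrr.
by rewrite /okubo_delta !mul0r subr0.
Qed.

Lemma lin_neq0 g h x : okubo_delta g h = 1 -> x != 0 -> lin g h x != 0.
Proof.
by move=> gh1; apply: contra_neq => e; apply: (lin_inj gh1); rewrite lin0.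
Qed.

Lemma Z3_double (a : 'Z_3) : a + a = - a.
Proof. by case: a => [[|[|[|]]] // ?]; apply/val_inj. Qed.

Lemma Z3sq_double (g : Z3sq) : g + g = - g.
Proof.
by case: g => [[[|[|[|]]] // ?] [[|[|[|]]] // ?]]; congr pair; apply/val_inj.
Qed.

(** * Graded automorphisms of the Okubo algebra *)

Section OkuboAlgebra.
Variable F : fieldType.
Implicit Types (x y : okubo F).

Lemma okubo_z0 : okubo_z F 0 = 0.
Proof. by apply/ffunP => d; rewrite !ffunE (negbTE (valP d)). Qed.

Lemma okubo_z_scale_eq (a b : F) (g h : Z3sq) :
  g != 0 -> a != 0 -> a *: okubo_z F g = b *: okubo_z F h -> g = h /\ a = b.
Proof.
move=> g0 a0 /ffunP/(_ (exist _ g g0)); rewrite !ffunE /= eqxx.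
rewrite /GRing.scale /= mulr1; case: eqP => [->|_]; rewrite ?mulr1 ?mulr0 //.
by move=> a00; rewrite a00 eqxx in a0.
Qed.

Lemma okubo_z_neq0 (g : Z3sq) : g != 0 -> okubo_z F g != 0.
Proof.
move=> g0; apply/eqP => /ffunP/(_ (exist _ g g0)); rewrite !ffunE /= eqxx.
by move/eqP; rewrite oner_eq0.
Qed.

Lemma okubo_mulZ (a b : F) x y :
  okubo_mul (a *: x) (b *: y) = (a * b) *: okubo_mul x y.
Proof.
rewrite /okubo_mul scaler_sumr; apply: eq_bigr => d _.
rewrite scaler_sumr; apply: eq_bigr => e _.
by rewrite !ffunE scalerA /GRing.scale /= mulrACA.
Qed.

Lemma okubo_mul_suml I (r : seq I) (X : I -> okubo F) y :
  okubo_mul (\sum_(i <- r) X i) y = \sum_(i <- r) okubo_mul (X i) y.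
Proof.
rewrite /okubo_mul [RHS]exchange_big /=; apply: eq_bigr => d _.
rewrite [RHS]exchange_big /=; apply: eq_bigr => e _.
by rewrite sum_ffunE mulr_suml scaler_suml.
Qed.

Lemma okubo_mul_sumr I (r : seq I) x (Y : I -> okubo F) :
  okubo_mul x (\sum_(i <- r) Y i) = \sum_(i <- r) okubo_mul x (Y i).
Proof.
rewrite /okubo_mul [RHS]exchange_big /=; apply: eq_bigr => d _.
rewrite [RHS]exchange_big /=; apply: eq_bigr => e _.
by rewrite sum_ffunE mulr_sumr scaler_suml.
Qed.

Lemma okubo_mul_zz (g h : Z3sq) : g != 0 -> h != 0 ->
  okubo_mul (okubo_z F g) (okubo_z F h) = okubo_zmul F g h.
Proof. by move=> g0 h0; have := okubo_mul_z F (exist _ g g0) (exist _ h h0). Qed.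

Lemma okubo_morph_basis (f : 'End(okubo F)) :
  (forall d e : okubo_index,
     f (okubo_zmul F (val d) (val e))
     = okubo_mul (f (okubo_z F (val d))) (f (okubo_z F (val e)))) ->
  {morph f : x y / okubo_mul x y}.
Proof.
move=> fM x y; rewrite [in RHS](okubo_coord x) [in RHS](okubo_coord y).
rewrite [f (\sum_(d : _) x d *: _)]linear_sum [f (\sum_(d : _) y d *: _)]linear_sum.
rewrite /= okubo_mul_suml {1}/okubo_mul linear_sum; apply: eq_bigr => d _.
rewrite linear_sum okubo_mul_sumr; apply: eq_bigr => e _.
by rewrite [LHS]linearZ /= fM -okubo_mulZ; congr okubo_mul; rewrite linearZ.
Qed.

(** The structure constants as a function of the form. The exceptional case [g + h = 0] of the
    product needs no separate value, because [okubo_z 0 = 0]. *)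
Definition okubo_sign (a : 'Z_3) : F :=
  if a == 2%:R then 0 else if a == 1 then -1 else 1.

Lemma okubo_sign_eq0 a : (okubo_sign a == 0) = (a == 2%:R).
Proof.
rewrite /okubo_sign; case: ifP => _; first by rewrite eqxx.
by case: ifP => _; rewrite ?oppr_eq0 oner_eq0.
Qed.

Lemma okubo_zmulE (g h : Z3sq) :
  okubo_zmul F g h = okubo_sign (okubo_delta g h) *: okubo_z F (g + h).
Proof.
rewrite /okubo_zmul /okubo_sign; have [->|_] := eqVneq (g + h) 0.
  by rewrite orbT okubo_z0 scaler0.
by rewrite orbF; do 2?case: ifP => _; rewrite ?scale0r ?scaleN1r ?scale1r.
Qed.

End OkuboAlgebra.

Section GradedAut.
Variable F : fieldType.

(** Extending the data to the index 0 by [s 0 = 0] and [c 0 = 1] lets additivity and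
    multiplicativity be stated on the whole group (Z/3)^2. *)
Lemma graded_autE (f : okubo_graded_aut F) :
  exists s : Z3sq -> Z3sq, exists c : Z3sq -> F,
    [/\ injective s, s 0 = 0, c 0 = 1,
        forall g, c g != 0 & forall g, val f (okubo_z F g) = c g *: okubo_z F (s g)].
Proof.
have [[bij_f fM] [s sP]] := okubo_graded_autP f.
have fz d : exists c : F, val f (okubo_z F (val d)) = c *: okubo_z F (val (s d)).
  have := sP d; rewrite /okubo_component limg_line => e.
  by apply/vlineP; rewrite -e memv_line.
have {fz} [c cP] := choice fz.
pose s' g := if insub g is Some d then val (s d) else 0.
pose c' g := if insub g is Some d then c d else 1.
have s'0 : s' 0 = 0 by rewrite /s' insubF ?eqxx.
have s'E (d : okubo_index) : s' (val d) = val (s d) by rewrite /s' valK.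
have cases g : g = 0 \/ exists d : okubo_index, g = val d.
  by have [->|g0] := eqVneq g 0; [left | right; exists (exist _ g g0)].
exists s', c'; split=> // [g h||g|g].
- case: (cases g) (cases h) => [->|[d ->]] [->|[e ->]] //; rewrite ?s'0 ?s'E.
  + by move/esym=> e0; have := valP (s e); rewrite e0 eqxx.
  + by move=> d0; have := valP (s d); rewrite d0 eqxx.
  + by move/val_inj/perm_inj->.
- by rewrite /c' insubF ?eqxx.
- rewrite /c'; case: insubP => [d _ _|_]; rewrite ?oner_neq0 //.
  apply: contraTneq (okubo_z_neq0 F (valP d)) => c0; rewrite negbK.
  by rewrite -(inj_eq (bij_inj bij_f)) cP c0 scale0r linear0.
- case: (cases g) => [->|[d ->]]; last by rewrite s'E /c' valK cP.
  by rewrite s'0 okubo_z0 linear0 scaler0.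
Qed.

(** Everything is read off from products of basis vectors. The form is recovered from which products
    vanish, since the signs 1 and -1 coincide in characteristic 2. *)
Lemma graded_aut_symplectic (f : okubo_graded_aut F)
    (s : Z3sq -> Z3sq) (c : Z3sq -> F) :
    injective s -> s 0 = 0 -> c 0 = 1 -> (forall g, c g != 0) ->
    (forall g, val f (okubo_z F g) = c g *: okubo_z F (s g)) ->
  [/\ {morph s : g h / g + h}, forall g h, c (g + h) = c g * c h
    & forall g h, okubo_delta (s g) (s h) = okubo_delta g h].
Proof.
move=> s_inj s0 c01 c0 fz; have [[bij_f fM] _] := okubo_graded_autP f.
have s_neq0 g : g != 0 -> s g != 0 by rewrite -{2}s0 (inj_eq s_inj).
have key g h : g != 0 -> h != 0 ->
    (okubo_sign F (okubo_delta g h) * c (g + h)) *: okubo_z F (s (g + h)) =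
    (c g * c h * okubo_sign F (okubo_delta (s g) (s h))) *: okubo_z F (s g + s h).
  move=> g0 h0; rewrite -[LHS]scalerA -[RHS]scalerA -fz -okubo_zmulE.
  rewrite -okubo_mul_zz ?s_neq0 //.
  by rewrite -okubo_mulZ -!fz -fM okubo_mul_zz // okubo_zmulE linearZ.
have keyD g h : g != 0 -> h != 0 -> g + h != 0 -> okubo_delta g h != 2%:R ->
    [/\ s (g + h) = s g + s h, okubo_delta (s g) (s h) != 2%:R
      & okubo_sign F (okubo_delta g h) * c (g + h)
        = c g * c h * okubo_sign F (okubo_delta (s g) (s h))].
  move=> g0 h0 gh0 d2.
  have nz : okubo_sign F (okubo_delta g h) * c (g + h) != 0.
    by rewrite mulf_neq0 // okubo_sign_eq0.
  have [-> ecc] := okubo_z_scale_eq (s_neq0 _ gh0) nz (key _ _ g0 h0).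
  split=> //; apply: contraNneq nz => d2'; rewrite ecc.
  by rewrite mulf_eq0 okubo_sign_eq0 d2' eqxx orbT.
have deltagg g : okubo_delta g g = 0 by rewrite /okubo_delta mulrC subrr.
have sN g : s (- g) = - s g.
  have [->|g0] := eqVneq g 0; first by rewrite s0 !oppr0 s0.
  rewrite -!Z3sq_double; have gg0 : g + g != 0 by rewrite Z3sq_double oppr_eq0.
  by have [] := keyD g g; rewrite ?deltagg.
(* The product vanishes, hence so does that of the images; as [s g + s h] is nonzero, only the value
   2 of the form can be the cause. *)
have sdelta2 g h : okubo_delta g h = 2%:R -> okubo_delta (s g) (s h) = 2%:R.
  move=> d2; apply/eqP; rewrite -(okubo_sign_eq0 F).
  have g0 : g != 0.
    by apply: contra_eq_neq d2 => ->; rewrite /okubo_delta !mul0r subr0.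
  have h0 : h != 0.
    by apply: contra_eq_neq d2 => ->; rewrite /okubo_delta !mulr0 subr0.
  have gh0 : s g + s h != 0.
    rewrite addr_eq0 -sN (inj_eq s_inj).
    apply: contra_eq_neq d2 => ->.
    by rewrite (_ : okubo_delta _ _ = 0) // /okubo_delta /=; ring.
  have := key _ _ g0 h0; rewrite d2 {1}/okubo_sign eqxx mul0r scale0r.
  move/esym/eqP; rewrite scaler_eq0 (negbTE (okubo_z_neq0 F gh0)) orbF.
  by rewrite !mulf_eq0 !(negbTE (c0 _)).
(* The value 1 is the value 2 with the arguments swapped. If the form is 0, its image is not 2 in
   either order, hence is 0. *)
have sdelta g h : okubo_delta (s g) (s h) = okubo_delta g h.
  have [d|d|/[dup] d /sdelta2->//] := Z3_cases (okubo_delta g h); last first.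
    have: okubo_delta h g = 2%:R by rewrite okubo_deltaC d; apply/val_inj.
    by move/sdelta2; rewrite okubo_deltaC d => /(canRL (@opprK _)) ->; apply/val_inj.
  have [->|g0] := eqVneq g 0; first by rewrite s0 /okubo_delta !mul0r.
  have [->|h0] := eqVneq h 0; first by rewrite s0 /okubo_delta !mulr0.
  have [/addr0_eq <-|gh0] := eqVneq (g + h) 0.
    by rewrite sN /okubo_delta /=; ring.
  have [|_ ne1 _] := keyD g h g0 h0 gh0; first by rewrite d.
  have [||_ ne2 _] := keyD h g h0 g0; first by rewrite addrC.
    by rewrite okubo_deltaC d.
  have [e|e|e] := Z3_cases (okubo_delta (s g) (s h)).
  - by rewrite e.
  - by rewrite okubo_deltaC e in ne2.
  - by rewrite e in ne1.
have cD g h : g != 0 -> h != 0 -> g + h != 0 ->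
    s (g + h) = s g + s h /\ c (g + h) = c g * c h.
  (* The form cannot be 2 in both orders, so swapping [g] and [h] avoids the vanishing product. *)
  move=> g0 h0 gh0; wlog d2 : g h g0 h0 gh0 / okubo_delta g h != 2%:R.
    move=> IH; have [d|d] := eqVneq (okubo_delta g h) 2%:R; last exact: IH.
    have [] := IH h g; rewrite 1?[h + g]addrC 1?okubo_deltaC ?d //.
    by rewrite [s h + _]addrC [c h * _]mulrC.
  have [-> _] := keyD _ _ g0 h0 gh0 d2; rewrite sdelta mulrC => /mulIf-> //.
  by rewrite okubo_sign_eq0.
(* As [- g = g + g], each of [c g] and [c (- g)] is the square of the other. *)
have cN g : c g * c (- g) = 1.
  have [->|g0] := eqVneq g 0; first by rewrite oppr0 c01 mulr1.
  have ng0 : - g != 0 by rewrite oppr_eq0.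
  have [|_] := cD g g g0 g0; rewrite Z3sq_double // => cg.
  have [|_] := cD _ _ ng0 ng0; rewrite Z3sq_double opprK // => cng.
  by apply: (mulfI (c0 g)); rewrite mulr1 mulrA -cg -cng.
have sc g h : s (g + h) = s g + s h /\ c (g + h) = c g * c h.
  have [->|g0] := eqVneq g 0; first by rewrite s0 c01 !add0r mul1r.
  have [->|h0] := eqVneq h 0; first by rewrite s0 c01 !addr0 mulr1.
  have [gh|gh0] := eqVneq (g + h) 0; last exact: cD.
  by rewrite gh -(addr0_eq gh) sN subrr cN.
by split=> // g h; have [] := sc g h.
Qed.

(** The factor [c] is a character of a group of exponent 3, so its values are cube roots of 1, that
    is, powers of [w]. *)
Lemma graded_aut_lin (w : F) (f : okubo_graded_aut F) : 3.-primitive_root w ->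
  exists g h k l, okubo_delta g h = 1 /\
    forall x, val f (okubo_z F x) = w ^+ chr k l x *: okubo_z F (lin g h x).
Proof.
move=> pw; have [s [c [s_inj s0 c01 c0 fz]]] := graded_autE f.
have [sD cD sdelta] := graded_aut_symplectic s_inj s0 c01 c0 fz.
have ck g : exists k : 'Z_3, c g = w ^+ k.
  have cg3 : c g ^+ 3 = 1.
    by rewrite !exprS expr0 mulr1 -!cD Z3sq_double subrr.
  by have [k ->] := prim_rootP pw cg3; exists k.
have [k kE] := ck Z3sq_e1; have [l lE] := ck Z3sq_e2.
exists (s Z3sq_e1), (s Z3sq_e2), k, l; split; first by rewrite sdelta; apply/val_inj.
move=> x; rewrite fz -(additive_lin s0 sD); congr (_ *: _).
move: x; apply: Z3sq_gen => [|||x y ex ey].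
- by rewrite c01 chr0.
- by rewrite kE chr_e1.
- by rewrite lE chr_e2.
- by rewrite cD ex ey chrD exprZ3D // (prim_expr_order pw).
Qed.

Section MonomialMap.
Variables (w : F) (g h : Z3sq) (k l : 'Z_3).
Hypotheses (pw : 3.-primitive_root w) (gh1 : okubo_delta g h = 1).

Fact lin_index_subproof (d : okubo_index) : lin g h (val d) != 0.
Proof. exact: lin_neq0 (valP d). Qed.

Definition lin_index (d : okubo_index) : okubo_index :=
  exist _ (lin g h (val d)) (lin_index_subproof d).

Lemma lin_index_inj : injective lin_index.
Proof. by move=> d e /(congr1 val)/(lin_inj gh1)/val_inj. Qed.

Definition monomial_map (x : okubo F) : okubo F :=
  \sum_(d : okubo_index) (w ^+ chr k l (val d) * x d) *: okubo_z F (val (lin_index d)).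

Fact monomial_map_linear : linear monomial_map.
Proof.
move=> a x y; rewrite /monomial_map scaler_sumr -big_split /=; apply: eq_bigr => d _.
by rewrite !ffunE scalerA -scalerDl mulrDr mulrCA.
Qed.
HB.instance Definition _ :=
  GRing.isLinear.Build F (okubo F) (okubo F) _ monomial_map monomial_map_linear.

Lemma monomial_map_z x :
  monomial_map (okubo_z F x) = w ^+ chr k l x *: okubo_z F (lin g h x).
Proof.
have [->|x0] := eqVneq x 0; first by rewrite okubo_z0 linear0 lin0 okubo_z0 scaler0.
rewrite /monomial_map (bigD1 (exist _ x x0)) //= big1 ?addr0 => [|d dx].
  by rewrite ffunE eqxx mulr1.
have -> : okubo_z F x d = 0.
  rewrite ffunE -[x]/(val (exist (fun x => x != 0) x x0)).
  by rewrite (inj_eq val_inj) (negbTE dx).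
by rewrite mulr0 scale0r.
Qed.

(** On basis vectors, determinant 1 preserves the structure constants and additivity of [chr] makes
    the scalar factors agree. *)
Lemma symplectic_graded_aut :
  exists f : okubo_graded_aut F,
    forall x, val f (okubo_z F x) = w ^+ chr k l x *: okubo_z F (lin g h x).
Proof.
pose f : 'End(okubo F) := linfun monomial_map.
have fz x : f (okubo_z F x) = w ^+ chr k l x *: okubo_z F (lin g h x).
  by rewrite lfunE /= monomial_map_z.
have w0 n : w ^+ n != 0 by apply: prim3_expr_neq0.
suff fP : is_okubo_aut f /\ permutes_components f.
  by exists (exist _ f (introT (asboolP _) fP)).
split; last first.
  exists (perm lin_index_inj) => d; rewrite /okubo_component limg_line fz permE.
  apply/eqP; rewrite eqEsubv -!memvE memvZ ?memv_line //=.
  by rewrite -[X in X \in _](scalerK (w0 (chr k l (val d)))) memvZ ?memv_line.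
split.
  have kf : lker f == 0%VS.
    apply/lker0P => x y /ffunP exy; apply/ffunP => d.
    have coord u : f u (lin_index d) = w ^+ chr k l (val d) * u d.
      rewrite lfunE /= /monomial_map sum_ffunE (bigD1 d) //= big1 ?addr0 => [|e ed].
        by rewrite !ffunE /= eqxx /GRing.scale /= mulr1.
      rewrite !ffunE /= (inj_eq (lin_inj gh1)).
      have -> : (sval d == sval e) = false.
        by apply: contra_neqF ed => /eqP de; apply: val_inj.
      by rewrite /GRing.scale /= mulr0.
    by have := exy (lin_index d); rewrite !coord => /(mulfI (w0 _)).
  by exists f^-1%VF; [apply: lker0_lfunK | apply: lker0_lfunVK].
apply: okubo_morph_basis => d e; rewrite !fz okubo_mulZ okubo_mul_zz.
- rewrite !okubo_zmulE linearZ /= fz okubo_delta_lin gh1 mul1r linD chrD.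
  by rewrite exprZ3D ?(prim_expr_order pw) // !scalerA mulrC.
- exact: lin_index_subproof.
- exact: lin_index_subproof.
Qed.

End MonomialMap.
End GradedAut.

(** * Weyl matrices *)

(** ['I_3] is convertible to ['Z_3], so matrix indices are added modulo 3 below. *)
Lemma sum_ord3 (V : nmodType) (G : 'I_3 -> V) :
  \sum_i G i = G (0 : 'Z_3) + G (1 : 'Z_3) + G (2%:R : 'Z_3).
Proof.
rewrite !big_ord_recl big_ord0 addr0 addrA.
by congr (G _ + G _ + G _); apply/val_inj.
Qed.

Section Weyl.
Variables (K : fieldType) (om : K).
Hypothesis om3 : 3.-primitive_root om.
Implicit Types (A : 'M[K]_3) (x y : Z3sq).

Let omD (a b : 'Z_3) : om ^+ (a + b)%R = om ^+ a * om ^+ b.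
Proof. exact: exprZ3D (prim_expr_order om3). Qed.

Let om_neq0 n : om ^+ n != 0.
Proof. exact: prim3_expr_neq0. Qed.

Lemma prim3_expr_inj : injective (fun a : 'Z_3 => om ^+ a).
Proof.
move=> a b /= eab; apply/subr0_eq/(exprZ3_eq1 om3)/(mulIf (om_neq0 b)).
by rewrite -omD subrK mul1r.
Qed.

(* The exponent x.1 * (i + j), rather than the more usual x.1 * j, makes the
   cocycle of x |-> weyl x the symplectic form itself: see weylM. *)
Definition weyl x : 'M[K]_3 :=
  \matrix_(i, j) if (i : 'Z_3) == (j : 'Z_3) + x.2
                 then om ^+ (x.1 * ((i : 'Z_3) + j))%R else 0.

Lemma mulmx_weylE A x (i j : 'Z_3) :
  (A *m weyl x) i j = A i (j + x.2) * om ^+ (x.1 * (j + j + x.2))%R.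
Proof.
rewrite mxE (bigD1 (j + x.2)) // big1 => [|k /andP[_ jk]].
  by rewrite mxE eqxx [j + x.2 + j]addrAC; apply: addr0.
by rewrite mxE (negbTE jk) mulr0.
Qed.

Lemma weyl_mulmxE A x (i j : 'Z_3) :
  (weyl x *m A) i j = om ^+ (x.1 * (i + i - x.2))%R * A (i - x.2) j.
Proof.
rewrite mxE (bigD1 (i - x.2)) // big1 => [|k /andP[_ ik]].
  by rewrite mxE subrK eqxx [i + (i - x.2)]addrA; apply: addr0.
by rewrite mxE -subr_eq eq_sym (negbTE ik) mul0r.
Qed.

Lemma weyl0 : weyl 0 = 1%:M.
Proof.
apply/matrixP => i j; rewrite !mxE.
rewrite -[(0 : Z3sq).1]/(0 : 'Z_3) -[(0 : Z3sq).2]/(0 : 'Z_3).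
by rewrite addr0 mul0r expr0; case: eqP.
Qed.

Lemma weylM x y : weyl x *m weyl y = om ^+ okubo_delta x y *: weyl (x + y).
Proof.
apply/matrixP => i j; rewrite mulmx_weylE !mxE -addrA [y.2 + _]addrC.
case: eqP => [->|_]; last by rewrite mul0r mulr0.
rewrite -!omD; congr (om ^+ nat_of_ord _); rewrite /okubo_delta.
case: x y (j : 'Z_3) => [a b] [c d] {}j; rewrite -[LHS]/(_ + _) /=; ring.
Qed.

(** The support of the matrix determines [x.2]; the exponents along the support then determine [k]
    and [x.1]. *)
Lemma scale_weyl_inj (k l : 'Z_3) x y :
  om ^+ k *: weyl x = om ^+ l *: weyl y -> k = l /\ x = y.
Proof.
move/matrixP => exy.
have x2 : x.2 = y.2.
  have := exy (0 + x.2 : 'Z_3) (0 : 'Z_3); rewrite !mxE eqxx.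
  rewrite (inj_eq (addrI _)); case: eqP => // _ /eqP.
  by rewrite mulr0 mulf_eq0 !(negbTE (om_neq0 _)).
have e j : k + x.1 * (j + j + x.2) = l + y.1 * (j + j + x.2).
  apply: prim3_expr_inj; cbv beta; rewrite !omD.
  have := exy (j + x.2 : 'Z_3) (j : 'Z_3); rewrite !mxE -x2 eqxx.
  by rewrite addrAC.
have kl : k = l.
  (* At [j = x.2] the coefficient [j + j + x.2] is 0, which isolates [k]; at [j = x.2 + 2] it is 4 =
     1, which isolates [x.1]. *)
  have := e x.2; rewrite (_ : x.2 + x.2 + x.2 = 0) ?mulr0 ?addr0 //.
  by case: x.2 => [[|[|[|]]] // ?]; apply/val_inj.
split=> //; have := e (x.2 + 2%:R); rewrite -kl => /addrI.
rewrite (_ : _ + _ + x.2 = 1); last first.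
  by case: x.2 => [[|[|[|]]] // ?]; apply/val_inj.
by rewrite !mulr1; case: x y x2 {exy e} => [a b] [c d] /= -> ->.
Qed.

(** [weyl Z3sq_e1] is diagonal with distinct eigenvalues, which makes [A] diagonal; [weyl Z3sq_e2]
    is a cyclic shift, which makes the diagonal constant. *)
Lemma weyl_commutant_scalar A :
  (forall x, A *m weyl x = weyl x *m A) -> is_scalar_mx A.
Proof.
move=> cA.
have offdiag (i j : 'Z_3) : i != j -> A i j = 0.
  move=> ij; have /matrixP/(_ i j) := cA Z3sq_e1.
  rewrite mulmx_weylE weyl_mulmxE -[Z3sq_e1.1]/(1 : 'Z_3) -[Z3sq_e1.2]/(0 : 'Z_3).
  rewrite !subr0 !addr0 !mul1r [LHS]mulrC.
  move/eqP; rewrite -subr_eq0 -mulrBl mulf_eq0 subr_eq0 => /orP[|/eqP//].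
  (* From [i + i = j + j]: doubling is negation modulo 3, hence injective. *)
  rewrite (inj_eq prim3_expr_inj) => /eqP e; case/eqP: ij.
  by rewrite -[i]opprK -[j]opprK -[- i]Z3_double -[- j]Z3_double e.
have diag (i : 'Z_3) : A (i + 1) (i + 1) = A i i.
  have /matrixP/(_ (i + 1) i) := cA Z3sq_e2.
  by rewrite mulmx_weylE weyl_mulmxE !mul0r expr0 mulr1 mul1r addrK.
apply/is_scalar_mxP; exists (A (0 : 'Z_3) (0 : 'Z_3)); apply/matrixP => i j.
rewrite !mxE; case: (eqVneq (i : 'Z_3) j) => [<-|/offdiag-> //]; rewrite mulr1n.
have d1 : A (1 : 'Z_3) (1 : 'Z_3) = A (0 : 'Z_3) (0 : 'Z_3).
  by rewrite -[in LHS](add0r (1 : 'Z_3)) diag.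
by have [->|->|->] := Z3_cases i; rewrite ?d1 // -d1; apply: (diag 1).
Qed.

(** For invertible [A] this describes conjugation of the Weyl matrices; without the inverse, the
    condition is linear in [A], hence stable under scaling. *)
Definition intertwines A (s : Z3sq -> Z3sq) (k : Z3sq -> 'Z_3) :=
  forall x, A *m weyl x = om ^+ k x *: (weyl (s x) *m A).

(** Passing to [x + y] through [weylM] brings in the form at [x], [y] on one side and at their
    images on the other; these factors cancel because the determinant is 1, so two generators
    suffice. *)
Lemma intertwines_lin A g h (k l : 'Z_3) : okubo_delta g h = 1 ->
  A *m weyl Z3sq_e1 = om ^+ k *: (weyl g *m A) ->
  A *m weyl Z3sq_e2 = om ^+ l *: (weyl h *m A) ->
  intertwines A (lin g h) (chr k l).
Proof.
move=> gh1 Ag Ah; apply: Z3sq_gen => [|||x y Ax Ay].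
- by rewrite lin0 weyl0 chr0 scale1r mulmx1 mul1mx.
- by rewrite lin_e1 chr_e1.
- by rewrite lin_e2 chr_e2.
apply: (scalerI (om_neq0 (okubo_delta x y))); rewrite scalemxAr -weylM.
rewrite mulmxA Ax -scalemxAl -mulmxA Ay -scalemxAr mulmxA weylM linD chrD.
rewrite okubo_delta_lin gh1 mul1r -scalemxAl !scalerA omD.
by congr (_ *: _); rewrite mulrC.
Qed.

Lemma intertwinesM A B s t k l : intertwines A s k -> intertwines B t l ->
  intertwines (A *m B) (s \o t) (fun x => l x + k (t x)).
Proof.
move=> As Bt x; rewrite -mulmxA Bt -scalemxAr [A *m (_ *m _)]mulmxA As -scalemxAl.
by rewrite scalerA omD mulmxA.
Qed.

Lemma intertwines_unique A s t k l : A \in unitmx ->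
  intertwines A s k -> intertwines A t l -> s =1 t /\ k =1 l.
Proof.
move=> uA As At; suff st x : k x = l x /\ s x = t x.
  by split=> x; have [] := st x.
apply: scale_weyl_inj; apply: (can_inj (mulmxK uA)).
by rewrite -!scalemxAl -As At.
Qed.

(** The quotient commutes with every Weyl matrix. The index 0 is exempt: [weyl 0] is the identity,
    and an automorphism gives no information there because [okubo_z 0 = 0]. *)
Lemma intertwines_quotient A B s t k l : B \in unitmx ->
  intertwines A s k -> intertwines B t l ->
  (forall x, x != 0 -> k x = l x /\ s x = t x) -> is_scalar_mx (invmx B *m A).
Proof.
move=> uB As Bt st; apply: weyl_commutant_scalar => x.
have [->|x0] := eqVneq x 0; first by rewrite weyl0 mulmx1 mul1mx.
have Binv : invmx B *m (om ^+ l x *: weyl (t x)) = weyl x *m invmx B.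
  apply: (can_inj (mulmxK uB)).
  by rewrite -mulmxA -scalemxAl -Bt (mulKmx uB) (mulmxKV uB).
have [kl sx] := st x x0.
by rewrite -mulmxA As kl sx scalemxAl mulmxA Binv mulmxA.
Qed.

End Weyl.

(** * Unitary matrices over the field with four elements *)

(* The pair (a, b) stands for a + b omega in GF(4), omega^2 = 1 + omega. *)
Definition f4 := (bool * bool)%type.
Definition f4_add (x y : f4) : f4 := (x.1 (+) y.1, x.2 (+) y.2).
Definition f4_mul (x y : f4) : f4 :=
  ((x.1 && y.1) (+) (x.2 && y.2),
   (x.1 && y.2) (+) (x.2 && y.1) (+) (x.2 && y.2)).
Definition f4_conj (x : f4) : f4 := (x.1 (+) x.2, x.2).
Definition f4_omega (n : nat) : f4 := iter n (f4_mul (false, true)) (true, false).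

Definition f4s : seq f4 :=
  [:: (false, false); (true, false); (false, true); (true, true)].
Definition Z3s : seq 'Z_3 := [:: 0; 1; 2%:R].

Definition f4_sum (v : nat -> f4) : f4 :=
  f4_add (f4_add (v 0%N) (v 1%N)) (v 2%N).

Definition f4mx := (nat -> nat -> f4)%type.
Definition f4mx_mul (A B : f4mx) : f4mx :=
  fun i j => f4_sum (fun k => f4_mul (A i k) (B k j)).
Definition f4mx_weyl (x : Z3sq) : f4mx := fun i j =>
  (if i == (j + x.2) %% 3 then f4_omega (x.1 * ((i + j) %% 3) %% 3)
   else (false, false))%N.

Definition f4vec (r : seq f4) (i : nat) : f4 := nth (false, false) r i.
Definition f4rows (A : seq (seq f4)) : f4mx := fun i => f4vec (nth [::] A i).
Definition f4_dot (r s : nat -> f4) : f4 :=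
  f4_sum (fun j => f4_mul (r j) (f4_conj (s j))).

Definition f4_vecs : seq (seq f4) :=
  [seq a :: r | a <- f4s, r <- [seq [:: b; c] | b <- f4s, c <- f4s]].
Definition f4_units : seq (seq f4) :=
  [seq r <- f4_vecs | f4_dot (f4vec r) (f4vec r) == (true, false)].
Definition f4_orths (r : seq f4) : seq (seq f4) :=
  [seq s <- f4_units | f4_dot (f4vec r) (f4vec s) == (false, false)].
(** Orthonormal triples built one row at a time, which avoids scanning all 4^9 matrices. *)
Definition f4_unitaries : seq (seq (seq f4)) :=
  [seq r :: A | r <- f4_units,
     A <- [seq [:: s; t] | s <- f4_orths r,
             t <- [seq t <- f4_orths r
                  | f4_dot (f4vec s) (f4vec t) == (false, false)]]].

Definition Z3_Z3sq : seq ('Z_3 * Z3sq) :=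
  [seq (k, y) | k <- Z3s, y <- [seq (a, b) | a <- Z3s, b <- Z3s]].

Definition f4_images (A : seq (seq f4)) (x : Z3sq) : seq ('Z_3 * Z3sq) :=
  [seq p : 'Z_3 * Z3sq <- Z3_Z3sq
  | all (fun i => all (fun j =>
      f4mx_mul (f4rows A) (f4mx_weyl x) i j ==
      f4_mul (f4_omega p.1) (f4mx_mul (f4mx_weyl p.2) (f4rows A) i j))
    (iota 0 3)) (iota 0 3)].

Definition f4_actions : seq (('Z_3 * Z3sq) * ('Z_3 * Z3sq)) :=
  flatten [seq [seq (p, q) | p <- f4_images A Z3sq_e1, q <- f4_images A Z3sq_e2]
          | A <- f4_unitaries].

Definition f4_unitary (A : seq (seq f4)) : bool :=
  all (fun i => all (fun k =>
    f4_dot (f4rows A i) (f4rows A k) == (i == k, false)) (iota 0 3)) (iota 0 3).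

Lemma mem_f4s x : x \in f4s.
Proof. by case: x => [[] []]. Qed.

Lemma mem_Z3s a : a \in Z3s.
Proof. by have [-> | -> | ->] := Z3_cases a. Qed.

Lemma mem_f4_unitaries r0 r1 r2 :
  r0 \in f4_vecs -> r1 \in f4_vecs -> r2 \in f4_vecs ->
  f4_unitary [:: r0; r1; r2] -> [:: r0; r1; r2] \in f4_unitaries.
Proof.
move=> v0 v1 v2 /and4P[] /=.
move=> /and4P[u00 u01 u02 _] /and4P[_ u11 u12 _] /and4P[_ _ u22 _] _.
apply: allpairs_f_dep; first by rewrite mem_filter u00.
apply: allpairs_f_dep; first by rewrite !mem_filter u01 u11.
by rewrite !mem_filter u12 u02 u22.
Qed.

Lemma mem_f4_vecs a b c : [:: a; b; c] \in f4_vecs.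
Proof. by apply: allpairs_f; [|apply: allpairs_f]; apply: mem_f4s. Qed.

(** The enumeration imposes orthogonality of each pair of distinct rows in one order only; a run
    over the list verifies the other order. *)
Lemma f4_unitariesP A : A \in f4_unitaries -> f4_unitary A.
Proof. by apply/allP: A; vm_cast_no_check (erefl true). Qed.

Definition f4_symplectic_images A :=
  has (fun p => has (fun q => okubo_delta p.2 q.2 == 1) (f4_images A Z3sq_e2))
    (f4_images A Z3sq_e1).

(** Only the two basis vectors are tested; [intertwines_lin] extends the result to every index. *)
Lemma f4_unitaries_normalize : all f4_symplectic_images f4_unitaries.
Proof. by vm_cast_no_check (erefl true). Qed.

Lemma mem_Z3_Z3sq p : p \in Z3_Z3sq.
Proof.
by case: p => k [a b]; do 2![apply: allpairs_f; rewrite ?mem_Z3s //].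
Qed.

(** All 216 possible actions: 24 symplectic maps, each with 9 characters. *)
Definition symplectic_data : seq (('Z_3 * Z3sq) * ('Z_3 * Z3sq)) :=
  [seq pq <- [seq (p, q) | p <- Z3_Z3sq, q <- Z3_Z3sq]
  | okubo_delta pq.1.2 pq.2.2 == 1].

Lemma mem_symplectic_data p q :
  okubo_delta p.2 q.2 = 1 -> (p, q) \in symplectic_data.
Proof.
move=> pq1; rewrite mem_filter; apply/andP; split; first exact/eqP.
by apply: allpairs_f; apply: mem_Z3_Z3sq.
Qed.

(* [acts] is let-bound so that it is evaluated only once. *)
Lemma f4_actions_full :
  (let acts := f4_actions in all [pred d | d \in acts] symplectic_data) = true.
Proof. by vm_cast_no_check (erefl true). Qed.

(** * Transfer from pairs of bits to a field with four elements *)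

Section FieldFour.
Variable K : finFieldType.
Hypothesis cardK : #|K| = 4%N.

Lemma field4_prim3 : exists om : K, 3.-primitive_root om.
Proof.
have all3 : all 3.-unity_root (enum (predC1 (0 : K))).
  apply/allP => z; rewrite mem_enum inE => z0; apply/unity_rootP/(mulIf z0).
  by rewrite -exprSr -cardK expf_card mul1r.
have := has_prim_root _ all3 (enum_uniq _).
by rewrite -cardE cardC1 cardK => /(_ isT isT)/hasP[om _]; exists om.
Qed.

Variable om : K.
Hypothesis om3 : 3.-primitive_root om.

Let K2 : 2%N \in [pchar K]. Proof. exact: field4_pchar2. Qed.

(** Dividing [om ^+ 3 - 1 = 0] by [om - 1] gives the relation up to signs, which disappear in
    characteristic 2. *)
Lemma omega_sqr : om * om = 1 + om.
Proof.
have om1 : om - 1 != 0.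
  by rewrite subr_eq0 -(expr1 om) -(prim_order_dvd om3).
apply/eqP; rewrite -subr_eq0 oppr_pchar2 //; apply/eqP/(mulfI om1).
rewrite mulr0; transitivity (om ^+ 3 - 1); first by ring.
by rewrite (prim_expr_order om3) subrr.
Qed.

Definition f4K (x : f4) : K := x.1%:R + x.2%:R * om.

Let natr_addb (a b : bool) : (a (+) b)%:R = a%:R + b%:R :> K.
Proof. by case: a b => [] []; rewrite ?addr0 ?add0r // addrr_pchar2. Qed.

Let natr_andb (a b : bool) : (a && b)%:R = a%:R * b%:R :> K.
Proof. by case: a; rewrite ?mul1r ?mul0r. Qed.

Lemma f4K_add x y : f4K (f4_add x y) = f4K x + f4K y.
Proof. by rewrite /f4K /= !natr_addb; ring. Qed.

Lemma f4K_mul x y : f4K (f4_mul x y) = f4K x * f4K y.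
Proof.
case: x y => a b [c d]; rewrite /f4K /= !natr_addb !natr_andb.
transitivity (a%:R * c%:R + (a%:R * d%:R + b%:R * c%:R) * om
              + b%:R * d%:R * (om * om)); last by ring.
by rewrite omega_sqr; ring.
Qed.

Lemma f4K_conj x : f4K (f4_conj x) = f4K x ^+ 2.
Proof. by rewrite expr2 -f4K_mul; case: x => [[] []]. Qed.

Lemma f4K_omega n : f4K (f4_omega n) = om ^+ n.
Proof.
elim: n => [|n IH]; first by rewrite /f4K /= mul0r addr0.
rewrite exprS -IH -[f4_omega n.+1]/(f4_mul (false, true) _) f4K_mul.
by rewrite /f4K /= add0r mul1r.
Qed.

Lemma f4K_sum v : f4K (f4_sum v) = f4K (v 0%N) + f4K (v 1%N) + f4K (v 2%N).
Proof. by rewrite !f4K_add. Qed.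

Lemma f4K_bij : bijective f4K.
Proof.
have om0 : om != 0 by rewrite -(expr1 om) prim3_expr_neq0.
apply: inj_card_bij; last by rewrite cardK card_prod card_bool.
(* In characteristic 2, equal images mean that the sum of the two pairs is sent to 0, and no nonzero
   pair is. *)
move=> x y /eqP; rewrite -subr_eq0 oppr_pchar2 // -f4K_add => xy0.
suff: f4_add x y = (false, false) by case: x y {xy0} => [[] []] [[] []].
case: (f4_add x y) xy0 => [[] []] //; rewrite /f4K /= ?mul1r ?mul0r ?addr0 ?add0r.
- by rewrite -omega_sqr mulf_eq0 (negbTE om0).
- by rewrite oner_eq0.
- by rewrite (negbTE om0).
Qed.

Definition f4mxK (A : f4mx) : 'M[K]_3 := \matrix_(i, j) f4K (A i j).

Lemma f4mxK_mul A B : f4mxK A *m f4mxK B = f4mxK (f4mx_mul A B).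
Proof.
apply/matrixP => i j; rewrite !mxE sum_ord3 f4K_sum !f4K_mul !mxE.
by [].
Qed.

Lemma f4mxK_weyl x : f4mxK (f4mx_weyl x) = weyl om x.
Proof.
apply/matrixP => i j; rewrite !mxE /f4mx_weyl.
rewrite -[(i : nat) == _]/((i : 'Z_3) == (j : 'Z_3) + x.2).
case: ifP => _; first by rewrite f4K_omega.
by rewrite /f4K /= mul0r addr0.
Qed.

(** The boolean test compares rows, hence computes [M *m dagger M], whereas unitarity has the
    factors in the other order; [mulmx1C] exchanges them. *)
Lemma f4_unitaryP (A : seq (seq f4)) :
  reflect (dagger (f4mxK (f4rows A)) *m f4mxK (f4rows A) = 1%:M) (f4_unitary A).
Proof.
pose M := f4mxK (f4rows A).
have entry (i k : 'Z_3) : (M *m dagger M) i k = f4K (f4_dot (f4rows A i) (f4rows A k)).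
  by rewrite mxE sum_ord3 f4K_sum !f4K_mul !f4K_conj !mxE.
have delta (i k : 'Z_3) : (1%:M : 'M[K]_3) i k = f4K (i == k, false).
  by rewrite mxE /f4K /= mul0r addr0.
apply: (iffP allP) => [uA|uA i].
  apply: mulmx1C; apply/matrixP => i k; rewrite entry delta; congr f4K; apply/eqP.
  have := uA i; rewrite mem_iota ltn_ord => /(_ isT)/allP/(_ k).
  by rewrite mem_iota ltn_ord => /(_ isT).
rewrite mem_iota add0n => i3; apply/allP => k; rewrite mem_iota add0n => k3.
apply/eqP/(bij_inj f4K_bij); have /matrixP/(_ (Ordinal i3) (Ordinal k3)) := mulmx1C uA.
rewrite (entry (Ordinal i3) (Ordinal k3)) => ->.
exact: delta (Ordinal i3) (Ordinal k3).
Qed.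

Lemma f4_imagesP (A : seq (seq f4)) x p : p \in f4_images A x ->
  f4mxK (f4rows A) *m weyl om x = om ^+ p.1 *: (weyl om p.2 *m f4mxK (f4rows A)).
Proof.
rewrite mem_filter => /andP[/allP Ap _].
rewrite -!f4mxK_weyl !f4mxK_mul; apply/matrixP => i j; rewrite !mxE.
have /Ap/allP/(_ j) : (i : nat) \in iota 0 3 by rewrite mem_iota ltn_ord.
by rewrite mem_iota ltn_ord => /(_ isT)/eqP->; rewrite f4K_mul f4K_omega.
Qed.

Lemma unitary_symplectic (M : 'M[K]_3) : dagger M *m M = 1%:M ->
  exists g h k l, okubo_delta g h = 1 /\ intertwines om M (lin g h) (chr k l).
Proof.
have [q fK qK] := f4K_bij.
(* [q] inverts [f4K], so [A] is [M] written in pairs of bits. *)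
pose A := [seq [seq q (M i j) | j : 'Z_3 <- Z3s] | i : 'Z_3 <- Z3s].
have <- : f4mxK (f4rows A) = M.
  apply/matrixP => i j; rewrite mxE -[RHS]qK; congr f4K.
  by have [->|->|->] := Z3_cases i; have [->|->|->] := Z3_cases j.
move=> /f4_unitaryP uA.
have := allP f4_unitaries_normalize A.
rewrite mem_f4_unitaries ?mem_f4_vecs // => /(_ isT).
case/hasP=> p pA /hasP[p' pA' /eqP d1].
exists p.2, p'.2, p.1, p'.1; split=> //.
by apply: intertwines_lin => //; apply: f4_imagesP.
Qed.

Lemma symplectic_unitary g h k l : okubo_delta g h = 1 ->
  exists2 M : 'M[K]_3, dagger M *m M = 1%:M
    & intertwines om M (lin g h) (chr k l).
Proof.
move=> gh1.
have dA : ((k, g), (l, h)) \in f4_actions.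
  by move/allP: f4_actions_full; apply; apply: mem_symplectic_data.
have /flattenP[acts /mapP[A uA ->] /allpairsP[[p q] [pA qA [pE qE]]]] := dA.
exists (f4mxK (f4rows A)); first exact/f4_unitaryP/f4_unitariesP.
move: pA qA; rewrite -[(p, q).1]/p -[(p, q).2]/q -pE -qE => gA hA.
by apply: intertwines_lin => //; [apply: f4_imagesP gA | apply: f4_imagesP hA].
Qed.

End FieldFour.

(** * The isomorphism *)

Section Matching.
Variables (F : fieldType) (K : finFieldType) (w : F) (om : K).
Hypotheses (w3 : 3.-primitive_root w) (om3 : 3.-primitive_root om).

(** Graph of the isomorphism before scalars are divided out. Leaving [s] and [k] arbitrary functions
    avoids carrying linearity through products. *)
Definition matches (f : okubo_graded_aut F) (A : 'M[K]_3) : Prop :=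
  exists s k, (forall x, val f (okubo_z F x) = w ^+ nat_of_ord (k x) *: okubo_z F (s x))
    /\ intertwines om A s k.

(** Automorphisms and matrices compose their data by the same law, in the same order. *)
Lemma matchesM f g A B :
  matches f A -> matches g B -> matches (f * g)%g (A *m B).
Proof.
move=> [s [k [fs As]]] [t [l [gt Bt]]].
exists (s \o t), (fun x => l x + k (t x)); split; last exact: intertwinesM.
move=> x; rewrite -[val (f * g)%g]/(val f \o val g)%VF comp_lfunE gt linearZ /= fs.
by rewrite scalerA exprZ3D ?(prim_expr_order w3).
Qed.

Lemma matchesZ f A (c : K) : matches f A -> matches f (c *: A).
Proof.
move=> [s [k [fs As]]]; exists s, k; split=> // x.
by rewrite -scalemxAl As -scalemxAr !scalerA mulrC.
Qed.

Lemma matches_inj f g A : A \in unitmx -> matches f A -> matches g A -> f = g.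
Proof.
move=> uA [s [k [fs As]]] [t [l [gt At]]].
have [st kl] := intertwines_unique om3 uA As At.
apply/val_inj/lfunP => u; rewrite [u]okubo_coord !linear_sum.
by apply: eq_bigr => d _; rewrite !linearZ /= fs gt st kl.
Qed.

Lemma matches_scalar f A B : B \in unitmx ->
  matches f A -> matches f B -> is_scalar_mx (invmx B *m A).
Proof.
move=> uB [s [k [fs As]]] [t [l [ft Bt]]].
apply: (intertwines_quotient om3 uB As Bt) => x x0.
have [[bij_f _] _] := okubo_graded_autP f.
have w0 n : w ^+ n != 0 by apply: prim3_expr_neq0.
(* Comparing indices and scalars requires a nonzero basis vector; injectivity of [f] provides it. *)
have sx0 : s x != 0.
  apply: contraNneq (okubo_z_neq0 F x0) => sx0.
  by rewrite -(inj_eq (bij_inj bij_f)) fs sx0 okubo_z0 scaler0 linear0.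
have [] := okubo_z_scale_eq sx0 (w0 _) (etrans (esym (fs x)) (ft x)).
by move=> -> /(prim3_expr_inj w3).
Qed.

Hypothesis cardK : #|K| = 4%N.

Lemma unitary_GL (A : 'M[K]_3) : dagger A *m A = 1%:M ->
  exists2 a : {'GL_3[K]}, a \in unitary3 cardK & GLval a = A.
Proof.
move=> uA; have [_ uA'] := mulmx1_unit uA.
by exists (FinRing.unit 'M[K]_3 uA'); rewrite // inE; apply/eqP.
Qed.

Lemma unitary3P (a : {'GL_3[K]}) :
  reflect (dagger (GLval a) *m GLval a = 1%:M) (a \in unitary3 cardK).
Proof. by rewrite inE; apply: eqP. Qed.

Lemma graded_aut_matches f :
  exists a : {'GL_3[K]}, a \in unitary3 cardK /\ matches f (GLval a).
Proof.
have [g [h [k [l [gh1 fz]]]]] := graded_aut_lin f w3.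
have [A /unitary_GL[a ua <-] Agh] := symplectic_unitary cardK om3 k l gh1.
by exists a; split=> //; exists (lin g h), (chr k l).
Qed.

Lemma unitary_matches (a : {'GL_3[K]}) :
  a \in unitary3 cardK -> exists f, matches f (GLval a).
Proof.
move=> /unitary3P ua.
have [g [h [k [l [gh1 Agh]]]]] := unitary_symplectic cardK om3 ua.
have [f fz] := symplectic_graded_aut k l w3 gh1.
by exists f, (lin g h), (chr k l).
Qed.

Lemma matches_coset f (a b : {'GL_3[K]}) :
    a \in unitary3 cardK -> b \in unitary3 cardK ->
    matches f (GLval a) -> matches f (GLval b) ->
  coset (scalar_unitary3 cardK) a = coset (scalar_unitary3 cardK) b.
Proof.
move=> ua ub fa fb; rewrite -[a](mulKVg b) coset_kerr // inE groupM ?groupV //=.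
exact: matches_scalar (GL_unitmx b) fa fb.
Qed.

Lemma coset_matches f (a b : {'GL_3[K]}) :
    a \in unitary3 cardK -> b \in unitary3 cardK ->
    coset (scalar_unitary3 cardK) a = coset (scalar_unitary3 cardK) b ->
  matches f (GLval b) -> matches f (GLval a).
Proof.
have /normal_norm/subsetP nU := scalar_unitary3_normal cardK.
move=> ua ub /(rcoset_kercosetP (nU _ ua) (nU _ ub))/rcosetP[c].
rewrite inE => /andP[_ /is_scalar_mxP[z cz]] ->.
by rewrite -[GLval (c * b)%g]/(GLval c *m GLval b) cz mul_scalar_mx; apply: matchesZ.
Qed.

End Matching.

Theorem theorem4p8 (F : fieldType) (K : finFieldType)
    (charF : 3%N \notin [pchar F])
    (rootF : exists w : F, 3.-primitive_root w)
    (cardK : #|K| = 4%N) :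
  group_isomorphic (okubo_graded_aut F) [subg (projective_unitary3 cardK)].
Proof.
have [w w3] := rootF; have [om om3] := field4_prim3 cardK.
(* One matching unitary matrix per automorphism; by [matches_coset] its coset does not depend on
   this choice. *)
have [a aP] := choice (graded_aut_matches w3 om3 cardK).
have a_unitary f : a f \in unitary3 cardK by have [] := aP f.
have a_matches f : matches w om f (GLval (a f)) by have [] := aP f.
have /normal_norm/subsetP nU := scalar_unitary3_normal cardK.
have aPU f : coset (scalar_unitary3 cardK) (a f) \in projective_unitary3 cardK.
  exact: mem_quotient.
pose phi f := subg (projective_unitary3 cardK) (coset (scalar_unitary3 cardK) (a f)).
exists phi; split; last first.
  (* [a (f * g)] and [a f * a g] both match [f * g], hence lie in the same coset. *)
  move=> f g; rewrite /phi -subgM // -morphM ?nU //; congr subg.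
  apply: (matches_coset w3 om3) (a_matches _) _; rewrite ?groupM //.
  exact: matchesM.
have phi_inj : injective phi.
  move=> f g /(congr1 sgval); rewrite !subgK // => fg.
  apply: (matches_inj om3 (GL_unitmx (a f)) (a_matches f)).
  exact: coset_matches fg (a_matches g).
(* A unitary lift of [y] matches some [f], as does [a f], so their cosets agree. *)
have /choice[psi psiK] y : exists f, phi f = y.
  have /morphimP[b nb ub yb] := subgP y.
  have [f fb] := unitary_matches w3 om3 ub; exists f.
  apply: val_inj; rewrite /= subgK // yb.
  exact: matches_coset (a_matches f) fb.
by exists psi => // f; apply: phi_inj.
Qed.
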